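(* Let $f=\frac1n\sum_{i=1}^n f_i$ where each $f_i:\mathbb{R}^d\to\mathbb{R}$ is differentiable, lower bounded, convex and $L_i$-smooth ($L_i>0$), and set $L_{\max}=\max_{i\in[n]}L_i$. Suppose that $f$ is $\mu$-strongly convex ($\mu>0$), with minimizer $x^*$, and let $0\le\rho\le\frac{1}{L_{\max}}$. Assume interpolation: $\sigma^2:=\mathbb{E}_{S_t}\left[f_{S_t}(x^* )-\ell_{S_t}^*\right]=0$. Let $(x^t)_{t\ge0}$ be the iterates of stochastic USAM with constant radius $\rho_t=\rho$ and the Stochastic Polyak Scheduler with $\gamma_b=\infty$ (i.e. without cap; defined in the context), started at $x^0\in\mathbb{R}^d$. Then for all $t\ge0$, $$\mathbb{E}\|x^t-x^*\|^2\le\left(1-\frac{\mu(1-L_{\max}\rho)^2}{4L_{\max}}\right)^t\|x^0-x^*\|^2.$$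
   Context: $\|\cdot\|$ is the Euclidean norm; $g$ is $L$-smooth if $\|\nabla g(x)-\nabla g(y)\|\le L\|x-y\|$ for all $x,y$; $f$ is $\mu$-strongly convex if $f-\frac\mu2\|\cdot\|^2$ is convex. Fix a mini-batch size $\tau\in\{1,\dots,n\}$. The mini-batches $S_0,S_1,\dots$ are i.i.d., each uniformly distributed over the subsets of $[n]=\{1,\dots,n\}$ of size $\tau$. For $S\subseteq[n]$ with $|S|=\tau$, $f_S=\frac1\tau\sum_{i\in S}f_i$, and $\ell_S^*\in\mathbb{R}$ is a given (deterministic) lower bound of $f_S$, i.e. $\ell_S^*\le f_S(x)$ for all $x$. Stochastic USAM with constant radius $\rho$ and the uncapped Stochastic Polyak Scheduler: for $t\ge0$, $$e^t=x^t+\rho\nabla f_{S_t}(x^t),\quad \gamma_t=\frac{f_{S_t}(e^t)-\ell_{S_t}^*-\rho\langle\nabla f_{S_t}(e^t),\nabla f_{S_t}(x^t)\rangle}{\|\nabla f_{S_t}(e^t)\|^2},\quad x^{t+1}=x^t-\gamma_t\nabla f_{S_t}(e^t).$$ Convention: if $\nabla f_{S_t}(e^t)=0$ then $x^{t+1}=x^t$. Expectation is over $S_0,S_1,\dots$. *)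

(* Defs.v *)
From HB Require Import structures.
From mathcomp Require Export all_boot all_order all_algebra.
From mathcomp Require Export finmap.
From mathcomp Require Export all_classical all_reals all_analysis.

Set Implicit Arguments.
Unset Strict Implicit.
Unset Printing Implicit Defensive.
Export Order.TTheory GRing.Theory Num.Theory numFieldNormedType.Exports.
Global Open Scope classical_set_scope.
Global Open Scope ring_scope.

(* The norm that the library puts on row vectors is the sup norm, so the
   Euclidean structure is defined here.  Differentiability does not depend
   on the choice of the norm. *)
Definition edot (R : realType) (d : nat) (u v : 'rV[R]_d) : R :=
  \sum_(j < d) u 0 j * v 0 j.

Definition enorm (R : realType) (d : nat) (u : 'rV[R]_d) : R :=
  Num.sqrt (edot u u).

Definition gradient (R : realType) (d : nat) (g : 'rV[R]_d -> R)
    (x : 'rV[R]_d) : 'rV[R]_d :=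
  \row_(j < d) 'D_(delta_mx 0 j) g x.

Definition lipschitz_gradient (R : realType) (d : nat) (L : R)
    (g : 'rV[R]_d -> R) : Prop :=
  forall x y : 'rV[R]_d,
    enorm (gradient g x - gradient g y) <= L * enorm (x - y).

Definition convex_on_space (R : realType) (d : nat) (g : 'rV[R]_d -> R) : Prop :=
  @convex_function R 'rV[R]_d setT g.

Definition strongly_convex (R : realType) (d : nat) (mu : R)
    (g : 'rV[R]_d -> R) : Prop :=
  convex_on_space (fun x => g x - mu / 2 * enorm x ^+ 2).

Definition full_loss (R : realType) (d n : nat) (f : 'I_n -> 'rV[R]_d -> R)
    (x : 'rV[R]_d) : R :=
  n%:R^-1 * \sum_(i < n) f i x.

Definition batch_loss (R : realType) (d n : nat) (f : 'I_n -> 'rV[R]_d -> R)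
    (tau : nat) (S : {set 'I_n}) (x : 'rV[R]_d) : R :=
  tau%:R^-1 * \sum_(i in S) f i x.

(* The default value 0 is harmless: it is only used for nonempty families of
   positive numbers. *)
Definition max_of (R : realType) (n : nat) (L : 'I_n -> R) : R :=
  \big[Num.max/0]_(i < n) L i.

Definition usam_ascent (R : realType) (d : nat) (rho : R)
    (g : 'rV[R]_d -> R) (x : 'rV[R]_d) : 'rV[R]_d :=
  x + rho *: gradient g x.

Definition sps_stepsize (R : realType) (d : nat) (rho ell : R)
    (g : 'rV[R]_d -> R) (x : 'rV[R]_d) : R :=
  let e := usam_ascent rho g x in
  (g e - ell - rho * edot (gradient g e) (gradient g x))
    / enorm (gradient g e) ^+ 2.

Definition usam_sps_step (R : realType) (d : nat) (rho ell : R)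
    (g : 'rV[R]_d -> R) (x : 'rV[R]_d) : 'rV[R]_d :=
  let e := usam_ascent rho g x in
  if gradient g e == 0 then x
  else x - sps_stepsize rho ell g x *: gradient g e.

(* The iterate x^t along a given realization s of the mini-batches. *)
Fixpoint usam_sps_iter (R : realType) (d n : nat)
    (f : 'I_n -> 'rV[R]_d -> R) (tau : nat) (ell : {set 'I_n} -> R) (rho : R)
    (x0 : 'rV[R]_d) (s : nat -> {set 'I_n}) (t : nat) : 'rV[R]_d :=
  if t is t'.+1 then
    usam_sps_step rho (ell (s t')) (batch_loss f tau (s t'))
      (usam_sps_iter f tau ell rho x0 s t')
  else x0.

(* Random elements of a finite type T, which carries the discrete
   sigma-algebra: all subsets of T are events. *)
Definition random_element (dsp : measure_display) (Omega : measurableType dsp)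
    (T : finType) (X : Omega -> T) : Prop :=
  forall A : set T, measurable (X @^-1` A).

Definition mutually_independent (R : realType) (dsp : measure_display)
    (Omega : measurableType dsp) (P : probability Omega R)
    (T : finType) (X : nat -> Omega -> T) : Prop :=
  forall (J : {fset nat}) (A : nat -> set T),
    P (\bigcap_(t in [set` J]) (X t @^-1` A t)) =
    (\prod_(t <- J) P (X t @^-1` A t))%E.

Definition uniform_batch (R : realType) (dsp : measure_display)
    (Omega : measurableType dsp) (P : probability Omega R)
    (n tau : nat) (X : Omega -> {set 'I_n}) : Prop :=
  forall B : {set 'I_n},
    P (X @^-1` [set B]) =
    (if #|B| == tau then ('C(n, tau)%:R^-1 : R)%:E else 0%E).

Definition iid_uniform_batches (R : realType) (dsp : measure_display)
    (Omega : measurableType dsp) (P : probability Omega R)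
    (n tau : nat) (X : nat -> Omega -> {set 'I_n}) : Prop :=
  [/\ forall t, random_element (X t),
      forall t, uniform_batch P tau (X t) &
      mutually_independent P X].

(* Main.v *)
Require Import Defs.
From mathcomp Require Import ring lra.

(* Interpolation forces f_B(x_star) = ell_B for every batch B of size tau, so
   ell_B is the minimum of g = f_B.  Write q = L rho, D = g(x) - ell_B,
   e = x + rho grad g(x), and let N be the numerator of the Polyak step size.
   Convexity at e gives N <= <grad g(e), x - x_star>, hence the step decreases
   |x - x_star|^2 by at least N^2 / |grad g(e)|^2 as soon as N >= 0.  The
   descent lemma from e to x and |grad g(x)|^2 <= 2 L D give
   N >= (1 - q^2) D, while |grad g(e)| <= (1 + q) |grad g(x)| gives
   |grad g(e)|^2 <= 2 L (1 + q)^2 D.  So the decrease is at least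
   (1 - q)^2 / (2 L) D; averaging over the batch turns D into
   f(x) - f(x_star) >= mu/2 |x - x_star|^2, a contraction for each fixed x,
   and independence of the batches iterates it. *)

(** * Euclidean inner product and norm *)

Section euclidean.
Context {R : realType} {d : nat}.
Implicit Types (u v w : 'rV[R]_d) (a : R).

Lemma edotC u v : edot u v = edot v u.
Proof. by apply: eq_bigr => j _; rewrite mulrC. Qed.

Lemma edotDl u v w : edot (u + v) w = edot u w + edot v w.
Proof. by rewrite -big_split; apply: eq_bigr => j _; rewrite mxE mulrDl. Qed.

Lemma edotZl a u v : edot (a *: u) v = a * edot u v.
Proof. by rewrite mulr_sumr; apply: eq_bigr => j _; rewrite mxE mulrA. Qed.

Lemma edotNl u v : edot (- u) v = - edot u v.
Proof. by rewrite -scaleN1r edotZl mulN1r. Qed.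

Lemma edotDr u v w : edot u (v + w) = edot u v + edot u w.
Proof. by rewrite edotC edotDl !(edotC u). Qed.

Lemma edotZr a u v : edot u (a *: v) = a * edot u v.
Proof. by rewrite edotC edotZl edotC. Qed.

Lemma edotNr u v : edot u (- v) = - edot u v.
Proof. by rewrite edotC edotNl edotC. Qed.

Definition edotE := (edotDl, edotDr, edotNl, edotNr, edotZl, edotZr).

Lemma edot_ge0 u : 0 <= edot u u.
Proof. by apply: sumr_ge0 => j _; rewrite -expr2 sqr_ge0. Qed.

Lemma edot_eq0 u : (edot u u == 0) = (u == 0).
Proof.
apply/eqP/eqP => [/psumr_eq0P u0|->]; last first.
  by apply: big1 => j _; rewrite mxE mul0r.
apply/rowP => j; rewrite mxE; apply/eqP; rewrite -sqrf_eq0 expr2; apply/eqP.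
by apply: u0 => // i _; rewrite -expr2 sqr_ge0.
Qed.

Lemma enorm_ge0 u : 0 <= enorm u.
Proof. exact: sqrtr_ge0. Qed.

Lemma sqr_enorm u : enorm u ^+ 2 = edot u u.
Proof. by rewrite sqr_sqrtr ?edot_ge0. Qed.

Lemma enorm_eq0 u : (enorm u == 0) = (u == 0).
Proof. by rewrite -sqrf_eq0 sqr_enorm edot_eq0. Qed.

Lemma enorm0 : enorm (0 : 'rV[R]_d) = 0.
Proof. by apply/eqP; rewrite enorm_eq0. Qed.

Lemma enormZ a u : enorm (a *: u) = `|a| * enorm u.
Proof.
by rewrite /enorm edotZl edotZr mulrA -expr2 sqrtrM ?sqr_ge0 // sqrtr_sqr.
Qed.

(** Cauchy-Schwarz: for [v != 0], the squared norm of [|v|^2 u - <u,v> v] is nonnegative and equals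
    [|v|^2 (|u|^2 |v|^2 - <u,v>^2)]. *)
Lemma edot_le_enorm u v : edot u v <= enorm u * enorm v.
Proof.
have [->|v0] := eqVneq v 0.
  by rewrite enorm0 mulr0 -(scale0r (0 : 'rV[R]_d)) edotZr mul0r.
have vp : 0 < edot v v by rewrite lt_def edot_eq0 v0 edot_ge0.
have /= := edot_ge0 (edot v v *: u - edot u v *: v).
rewrite !edotE (edotC v u) => h.
have h2 : edot u v ^+ 2 <= edot u u * edot v v.
  rewrite -(ler_pM2l vp) -subr_ge0; apply: le_trans h _.
  by rewrite le_eqVlt; apply/orP; left; apply/eqP; ring.
apply: le_trans (ler_norm _) _.
by rewrite -sqrtr_sqr -sqrtrM ?edot_ge0 // ler_wsqrtr.
Qed.

Lemma ler_enormD u v : enorm (u + v) <= enorm u + enorm v.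
Proof.
rewrite -(@ler_pXn2r _ 2) ?nnegrE ?addr_ge0 ?enorm_ge0 //.
rewrite sqr_enorm sqrrD !sqr_enorm !edotE (edotC v u).
have := edot_le_enorm u v; lra.
Qed.

Lemma ler_enorm_sum (I : Type) (r : seq I) (P : pred I) (F : I -> 'rV[R]_d) :
  enorm (\sum_(i <- r | P i) F i) <= \sum_(i <- r | P i) enorm (F i).
Proof.
elim/big_ind2: _ => [|u a v b ha hb|//]; first by rewrite enorm0.
by apply: le_trans (ler_enormD _ _) _; exact: lerD.
Qed.

End euclidean.

(** * First-order inequalities for convex and for smooth functions *)

Section convexity.
Context {R : realType} {d : nat}.
Implicit Types (g : 'rV[R]_d -> R) (x y v : 'rV[R]_d).

Lemma convex_on_spaceP g x y (t : R) : convex_on_space g -> 0 <= t <= 1 ->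
  g (x + t *: (y - x)) <= g x + t * (g y - g x).
Proof.
move=> cg /andP[t0 t1].
have := cg (Itv01 t0 t1) y x (mem_set I) (mem_set I).
rewrite convRE /= /conv /= /unstable.onem /=.
rewrite (_ : t *: y + (1 - t) *: x = x + t *: (y - x)); last first.
  by rewrite scalerBl scale1r scalerBr addrCA addrA addrAC.
by move=> /le_trans; apply; lra.
Qed.

(** The differential is linear, so expanding [v] in the standard basis recovers the partial
    derivatives that make up [gradient]. *)
Lemma derive_edot g x v : differentiable g x ->
  'D_v g x = edot (gradient g x) v.
Proof.
move=> dg; rewrite deriveE // {1}[v]row_sum_delta linear_sum.
by apply: eq_bigr => j _; rewrite linearZ /= mxE deriveE // mulrC.
Qed.

(** For [0 < h <= 1], convexity bounds the difference quotient in direction [y - x] by [g y - g x].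
    The two-sided limit exists, so it can be computed from the right, where this bound is
    available. *)
Lemma convex_gradient_le g x y : convex_on_space g -> differentiable g x ->
  g x + edot (gradient g x) (y - x) <= g y.
Proof.
move=> cg dg; rewrite -derive_edot // -lerBrDl.
have dq : derivable g x (y - x) by exact: diff_derivable.
rewrite /derive cvg_at_rightE //; apply: limr_le.
  by have /cvg_ex[l /cvg_dnbhs_at_right ql] := dq; apply/cvg_ex; exists l.
near=> h.
have h0 : 0 < h by near: h; exact: nbhs_right_gt.
have h1 : h <= 1 by near: h; exact: nbhs_right_le.
rewrite /= [_ *: _]mulrC ler_pdivrMr // lerBlDl (addrC _ x) [_ * h]mulrC.
by apply: convex_on_spaceP => //; rewrite (ltW h0).
Unshelve. all: by end_near. Qed.

Lemma is_derive_line g x v (s : R) : differentiable g (x + s *: v) ->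
  is_derive s 1 (fun t => g (x + t *: v)) (edot (gradient g (x + s *: v)) v).
Proof.
move=> dg; rewrite -derive_edot //.
have e : (fun h : R => h^-1 *: (((fun t => g (x + t *: v)) \o shift s) (h *: 1)
           - g (x + s *: v))) =
         (fun h : R => h^-1 *: ((g \o shift (x + s *: v)) (h *: v)
           - g (x + s *: v))).
  by apply/funext => h /=; rewrite [h *: 1]mulr1 scalerDl addrCA.
have dv : derivable g (x + s *: v) v by exact: diff_derivable.
split; first by rewrite /derivable e.
by rewrite /derive e.
Qed.

(** Monotonicity replaces the usual integral along the segment: [psi] subtracts from [g] the linear
    and quadratic terms of the bound, so the claim reads [psi 1 <= psi 0]. By Cauchy-Schwarz and the
    Lipschitz gradient, [psi] has nonpositive derivative on the segment. *)
Lemma smooth_descent g L x y : (forall z, differentiable g z) ->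
  lipschitz_gradient L g ->
  g y <= g x + edot (gradient g x) (y - x) + L / 2 * enorm (y - x) ^+ 2.
Proof.
move=> dg lg; set v := y - x; set c := edot (gradient g x) v.
pose psi (s : R) := g (x + s *: v) - s * c - L / 2 * enorm v ^+ 2 * s ^+ 2.
have dpsi (s : R) : is_derive s 1 psi
    (edot (gradient g (x + s *: v) - gradient g x) v - L * enorm v ^+ 2 * s).
  have -> : psi = (fun s => g (x + s *: v)) - (c *: id) -
      ((L / 2 * enorm v ^+ 2) *: (id ^+ 2)).
    by apply/funext => r; rewrite /psi !fctE /= [c *: r]mulrC.
  have dl := is_derive_line _ _ _ _ (dg (x + s *: v)).
  apply: is_derive_eq; rewrite /c !edotE /GRing.scale /=; by field.
suff : psi 1 <= psi 0.
  rewrite /psi scale1r scale0r addr0 /v (addrC x) subrK -/v; lra.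
apply: (@ler0_derive1_nincr R psi 0 1) => // [r|].
- rewrite in_itv /= => /andP[r0 _]; rewrite derive1E; case: (dpsi r) => _ ->.
  rewrite subr_le0; apply: le_trans (edot_le_enorm _ _) _.
  have /(ler_wpM2r (enorm_ge0 v)) := lg (x + r *: v) x.
  by rewrite addrAC subrr add0r enormZ gtr0_norm // => h; rewrite (le_trans h) //; lra.
- apply: derivable_within_continuous => r _; by case: (dpsi r).
Qed.

End convexity.

(** * Decrease of the distance in one step on a fixed loss *)

Section usam_step.
Context {R : realType} {d : nat}.
Variables (g : 'rV[R]_d -> R) (L ell : R).
Hypotheses (dg : forall z, differentiable g z) (L0 : 0 < L).
Hypotheses (lg : lipschitz_gradient L g) (gl : forall z, ell <= g z).

(** The descent lemma is used at [x - L^-1 grad g(x)], the minimizer of its quadratic upper bound;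
    [ell] bounds the value there from below. *)
Lemma sqr_enorm_gradient_le x : enorm (gradient g x) ^+ 2 <= 2 * L * (g x - ell).
Proof.
have Ln0 : L != 0 by rewrite gt_eqF.
have yx : x - L^-1 *: gradient g x - x = - (L^-1 *: gradient g x).
  by rewrite addrAC subrr add0r.
have := le_trans (gl _) (smooth_descent _ _ x (x - L^-1 *: gradient g x) dg lg).
rewrite yx !sqr_enorm !edotE -subr_ge0.
rewrite -(@pmulr_rge0 _ (2 * L)) ?mulr_gt0 // => h.
rewrite -subr_ge0; apply: le_trans h _.
by rewrite le_eqVlt; apply/orP; left; apply/eqP; field.
Qed.

Lemma usam_sps_step_descent rho x xs : convex_on_space g ->
  0 <= rho -> L * rho <= 1 -> g xs = ell ->
  enorm (usam_sps_step rho ell g x - xs) ^+ 2 <=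
  enorm (x - xs) ^+ 2 - (1 - L * rho) ^+ 2 / (2 * L) * (g x - ell).
Proof.
move=> cg r0 Lr1 gxs; have Ln0 : L != 0 by rewrite gt_eqF.
rewrite /usam_sps_step /sps_stepsize; set e := usam_ascent rho g x.
set a := gradient g x; set b := gradient g e.
set q := L * rho in Lr1 *; have q0 : 0 <= q by rewrite mulr_ge0 // ltW.
set D := g x - ell; have D0 : 0 <= D by rewrite subr_ge0.
set N := g e - ell - rho * edot b a.
have xe : x - e = - (rho *: a) by rewrite /e /usam_ascent opprD addrA subrr add0r.
have ha : edot a a <= 2 * L * D by rewrite -sqr_enorm sqr_enorm_gradient_le.
have hN : (1 - q) * (1 + q) * D <= N.
  have := smooth_descent _ _ e x dg lg.
  rewrite -/b xe sqr_enorm !edotE => h.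
  have : L / 2 * rho ^+ 2 * edot a a <= L / 2 * rho ^+ 2 * (2 * L * D).
    by rewrite ler_wpM2l // !mulr_ge0 // ?invr_ge0 // ltW.
  have -> : L / 2 * rho ^+ 2 * (2 * L * D) = q ^+ 2 * D by rewrite /q; field.
  have -> : (1 - q) * (1 + q) * D = D - q ^+ 2 * D by ring.
  move: h; rewrite /N /D; lra.
have hconv : N <= edot b (x - xs).
  have := convex_gradient_le _ _ xs cg (dg e).
  have -> : xs - e = - (x - xs) + (x - e) by rewrite opprB addrA subrK.
  by rewrite -/b xe !edotE gxs /N; lra.
have hb : edot b b <= (1 + q) ^+ 2 * (2 * L * D).
  apply: (@le_trans _ _ ((1 + q) ^+ 2 * edot a a)); last first.
    by rewrite ler_wpM2l // sqr_ge0.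
  rewrite -!sqr_enorm -exprMn ler_pXn2r ?nnegrE ?mulr_ge0 ?enorm_ge0 ?addr_ge0 //.
  have -> : b = a + (b - a) by rewrite addrCA subrr addr0.
  apply: le_trans (ler_enormD _ _) _; rewrite mulrDl mul1r lerD2l.
  have := lg e x; rewrite -/a -/b.
  have -> : e - x = rho *: a by rewrite -[LHS]opprB xe opprK.
  by rewrite enormZ ger0_norm // mulrA.
have hq : (1 - q) ^+ 2 * D <= (1 - q) * (1 + q) * D.
  by rewrite expr2 -!mulrA ler_wpM2l ?subr_ge0 // ler_wpM2r //; lra.
have c0 : 0 <= (1 - q) ^+ 2 / (2 * L).
  by rewrite mulr_ge0 ?sqr_ge0 // invr_ge0 mulr_ge0 // ltW.
(* If [b = 0] the iterate stays put. Then [hconv] gives [N <= 0], so [hN] and [hq] force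
   [(1 - q)^2 D <= 0]: the claimed decrease is not positive. *)
have [b0|b0] := eqVneq b 0.
  have : N <= 0 by rewrite (le_trans hconv) // b0 -(scale0r b) edotZl mul0r.
  move=> N0; rewrite lerBrDr gerDl mulrAC.
  by rewrite pmulr_lle0 ?invr_gt0 ?mulr_gt0 // (le_trans hq) // (le_trans hN).
have B0 : 0 < edot b b by rewrite lt_def edot_eq0 b0 edot_ge0.
have N0 : 0 <= N.
  by apply: le_trans hN; rewrite !mulr_ge0 ?subr_ge0 ?addr_ge0.
(* Square [hN] and divide by [hb]: the factor [(1 + q)^2] and one [D] cancel. *)
have hNB : (1 - q) ^+ 2 / (2 * L) * D <= N ^+ 2 / edot b b.
  rewrite ler_pdivlMr //.
  apply: (@le_trans _ _ (((1 - q) * (1 + q) * D) ^+ 2)); last first.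
    by rewrite ler_pXn2r ?nnegrE // !mulr_ge0 ?subr_ge0 ?addr_ge0.
  have -> : ((1 - q) * (1 + q) * D) ^+ 2 =
    (1 - q) ^+ 2 / (2 * L) * D * ((1 + q) ^+ 2 * (2 * L * D)) by field.
  by rewrite ler_wpM2l // mulr_ge0.
have -> : x - N / enorm b ^+ 2 *: b - xs = (x - xs) - N / edot b b *: b.
  by rewrite addrAC sqr_enorm.
rewrite !sqr_enorm.
(* With [B = |b|^2], the new squared distance is [|u|^2 - 2 (N/B) <b,u> + N^2/B], at most
   [|u|^2 - N^2/B] because [N <= <b,u>] and [N >= 0]. *)
move: (x - xs) hconv => u hconv; rewrite !edotE (edotC u b).
have : N / edot b b * N <= N / edot b b * edot b u.
  by rewrite ler_wpM2l // divr_ge0 // ltW.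
have -> : N / edot b b * N = N ^+ 2 / edot b b by field; rewrite gt_eqF.
rewrite mulrN; have -> : N / edot b b * (N / edot b b * edot b b) = N ^+ 2 / edot b b.
  by field; rewrite gt_eqF.
lra.
Qed.

End usam_step.

(** * Quadratic growth around a minimizer *)

Section strong_convexity.
Context {R : realType} {d : nat}.

(** Strong convexity on the segment from [xs] to [x], together with minimality of [xs], gives
    [(1 - t) A <= g x - g xs] after division by [t]. Instead of letting [t] tend to 0, a suitable
    [t] refutes the contrary. *)
Lemma strongly_convex_growth (g : 'rV[R]_d -> R) mu xs x : strongly_convex mu g ->
  (forall z, g xs <= g z) -> mu / 2 * enorm (x - xs) ^+ 2 <= g x - g xs.
Proof.
move=> sg gmin; set A := mu / 2 * enorm (x - xs) ^+ 2.
have key (t : R) : 0 < t <= 1 -> (1 - t) * A <= g x - g xs.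
  move=> /andP[t0 t1]; rewrite -(ler_pM2l t0).
  have t01 : 0 <= t <= 1 by rewrite ltW.
  have := convex_on_spaceP _ xs x t sg t01.
  have := gmin (xs + t *: (x - xs)).
  have xE : x = xs + (x - xs) by rewrite addrCA subrr addr0.
  have -> : enorm x ^+ 2 = enorm (xs + (x - xs)) ^+ 2 by rewrite -xE.
  rewrite /A !sqr_enorm; move: (x - xs) => v; rewrite !edotE (edotC v xs).
  nra.
rewrite leNgt; apply/negP => lt_A.
have [A0|A0] := leP A 0.
  by have := key 1; rewrite ltr01 lexx /= => /(_ isT); lra.
have D0 : 0 <= g x - g xs by rewrite subr_ge0.
(* This makes [(1 - t) A] the midpoint of [A] and [g x - g xs], which exceeds [g x - g xs] and
   contradicts [key]. *)
pose t := (A - (g x - g xs)) / (2 * A).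
have tA : t * A = (A - (g x - g xs)) / 2 by rewrite /t; field; rewrite gt_eqF.
have t0 : 0 < t by apply: divr_gt0; lra.
have t1 : t <= 1 by rewrite ler_pdivrMr; lra.
have := key t; rewrite t0 t1 => /(_ isT); rewrite mulrBl mul1r tA; lra.
Qed.

End strong_convexity.

(** * Expectation of a function of a finite-valued random element *)

Section finite_valued.
Context {R : realType} {dsp : measure_display} {Omega : measurableType dsp}.
Context (P : probability Omega R).

(** [h \o Y] is a finite combination of indicators of the fibres of [Y], which are integrable, so it
    can be integrated term by term. *)
Lemma expectation_fin (T : finType) (Y : Omega -> T) (h : T -> R) :
  (forall y, measurable (Y @^-1` [set y])) ->
  ('E_P[h \o Y] = (\sum_y h y * fine (P (Y @^-1` [set y])))%R%:E)%E.
Proof.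
move=> mY; rewrite unlock.
transitivity (\int[P]_w \sum_y ((h y)%:E * (\1_(Y @^-1` [set y]) w)%:E))%E.
  apply: eq_integral => w _ /=; rewrite (bigD1 (Y w)) //= indicE mem_set //.
  rewrite mule1 big1 ?adde0 // => y yY; rewrite indicE memNset ?mule0 //.
  by move=> /= Yy; rewrite Yy eqxx in yY.
have iY y : P.-integrable setT (EFin \o \1_(Y @^-1` [set y])).
  exact: integrable_indic.
rewrite integral_sum //; last by move=> y; apply: integrableZl => //; exact: iY.
rewrite -sumEFin; apply: eq_bigr => y _; rewrite integralZl //; last exact: iY.
by rewrite integral_indic // setIT EFinM fineK // fin_num_measure.
Qed.

End finite_valued.

(** * Finite histories of batches *)

Section histories.
Context {T : finType}.

(* Histories of length t form a finite type, so that the expectation of any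
   function of the first t batches is a finite sum. *)
Fixpoint hist (t : nat) : finType :=
  if t is t'.+1 then (hist t' * T)%type else unit.

Fixpoint hist_of (s : nat -> T) (t : nat) : hist t :=
  if t is t'.+1 return hist t then (hist_of s t', s t') else tt.

Fixpoint hist_state (A : Type) (step : T -> A -> A) (a : A) (t : nat) :
    hist t -> A :=
  if t is t'.+1 return hist t -> A
  then fun y => step y.2 (hist_state A step a t' y.1) else fun=> a.

(** Fixing a history means constraining each coordinate separately, which is the product form that
    [mutually_independent] speaks about. *)
Lemma hist_ofP (t : nat) (y : hist t) : exists A : nat -> set T,
  forall s, hist_of s t = y <-> forall i, (i < t)%N -> A i (s i).
Proof.
elim: t y => [[]|t IH [y b]] /=; first by exists (fun=> setT).
have [A hA] := IH y; exists (fun i => if i == t then [set b] else A i) => s.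
split=> [[/hA sA <-] i|sA].
  by rewrite ltnS leq_eqVlt; case: eqP => [-> _|_ /= it] //; exact: sA.
congr (_, _); last by have := sA t (ltnSn t); rewrite eqxx.
by apply/hA => i it; have := sA i (ltnW it); rewrite ltn_eqF.
Qed.

End histories.

(** * From a one-step contraction to a geometric rate in expectation *)

Section iid.
Context {R : realType} {dsp : measure_display} {Omega : measurableType dsp}.
Context (P : probability Omega R) (T : finType) (X : nat -> Omega -> T).
Hypotheses (mX : forall t, random_element (X t)).
Hypothesis iX : mutually_independent P X.

Let Y t w : hist t := hist_of (X^~ w) t.

Lemma hist_event t (y : hist t) : exists A : nat -> set T,
  Y t @^-1` [set y] = \bigcap_(i in [set` [fset i in iota 0 t]%fset]) (X i @^-1` A i).
Proof.
have [A hA] := hist_ofP t y; exists A; apply/seteqP; split => w /=.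
  by move=> /hA wA i /=; rewrite !inE mem_iota => /andP[_]; exact: wA.
by move=> wA; apply/hA => i it; apply: wA => /=; rewrite !inE mem_iota.
Qed.

Lemma measurable_hist t (y : hist t) : measurable (Y t @^-1` [set y]).
Proof.
have [A ->] := hist_event t y; apply: bigcap_measurableType => i _.
exact: mX.
Qed.

(** Both histories are intersections over finite index sets. The longer one adds the index [t],
    absent from [J], so its product of probabilities gains exactly one factor. *)
Lemma hist_indep t (y : hist t) b :
  P (Y t.+1 @^-1` [set (y, b)]) =
  (P (Y t @^-1` [set y]) * P (X t @^-1` [set b]))%E.
Proof.
have [A yA] := hist_event t y.
pose J := [fset i in iota 0 t]%fset.
pose A' i := if i == t then [set b] else A i.
have tJ : t \notin J by rewrite !inE mem_iota ltnn.
have eA i : i \in J -> A' i = A i.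
  by move=> iJ; rewrite /A'; case: eqP => // it; rewrite -it iJ in tJ.
have -> : Y t.+1 @^-1` [set (y, b)] =
    \bigcap_(i in [set` (t |` J)%fset]) (X i @^-1` A' i).
  apply/seteqP; split => w /=.
    move=> [Yy Xb] i /=; rewrite in_fset1U => /predU1P[->|iJ].
      by rewrite /A' eqxx.
    have : (Y t @^-1` [set y]) w by [].
    by rewrite yA eA //; apply.
  move=> wA; congr (_, _).
    suff : (Y t @^-1` [set y]) w by [].
    rewrite yA => i iJ; rewrite /= -eA //.
    by apply: wA; rewrite /= in_fset1U iJ orbT.
  by have := wA t; rewrite /A' /= eqxx; apply; rewrite in_fset1U eqxx.
rewrite iX big_fsetU1 //= {1}/A' eqxx yA iX muleC; congr (_ * _)%E.
by apply: eq_big_seq => i iJ; rewrite eA.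
Qed.

(** The finite sum [m k] plays the role of the expectation at time [k]. By [hist_indep], [m k.+1] is
    a double sum over a past and a fresh batch; the hypothesis for a fixed state bounds the inner
    sum, so no conditional expectation is involved. *)
Lemma iid_expectation_contraction (A : Type) (step : T -> A -> A) (a : A)
    (V : A -> R) (p : T -> R) (q : R) :
  (forall t b, P (X t @^-1` [set b]) = (p b)%:E) ->
  (forall x, 0 <= V x) ->
  (forall x, \sum_b p b * V (step b x) <= q * V x) ->
  forall t, ('E_P[fun w => V (hist_state A step a t (Y t w))] <=
             (q ^+ t * V a)%:E)%E.
Proof.
move=> pX V0 VC t.
rewrite (@expectation_fin _ _ _ P _ (Y t) (fun y => V (hist_state A step a t y)));
  last exact: measurable_hist.
rewrite lee_fin.
pose m t := \sum_(y : hist t) V (hist_state A step a t y) * fine (P (Y t @^-1` [set y])).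
rewrite -/(m t).
have p0 b : 0 <= p b by rewrite -lee_fin -(pX 0%N) measure_ge0.
have mS k : m k.+1 <= q * m k.
  rewrite mulr_sumr.
  rewrite (_ : m k.+1 = \sum_(y : hist k) \sum_b V (step b (hist_state A step a k y)) *
     (fine (P (Y k @^-1` [set y])) * p b)).
    apply: ler_sum => y _; rewrite mulrA.
    apply: le_trans (ler_wpM2r _ (VC (hist_state A step a k y))).
      rewrite mulr_suml le_eqVlt; apply/orP; left; apply/eqP.
      by apply: eq_bigr => b _; ring.
    by rewrite fine_ge0.
  rewrite pair_bigA; apply: eq_bigr => -[y b] _ /=.
  rewrite hist_indep fineM ?fin_num_measure ?pX //; [exact: measurable_hist|exact: mX].
have m0 : m 0%N = V a.
  rewrite /m (big_pred1 tt) /=; last by case.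
  rewrite (_ : _ @^-1` _ = setT) ?probability_setT ?mulr1 //.
  by apply/seteqP; split.
(* Nothing forces q >= 0, but for q < 0 the contraction makes V vanish. *)
have [q0|q0] := leP 0 q.
  elim: t => [|t IH]; first by rewrite m0 expr0 mul1r.
  by rewrite exprS -mulrA (le_trans (mS t)) // ler_wpM2l.
have VE x : V x = 0.
  apply/eqP; rewrite eq_le V0 andbT -(nmulr_rge0 _ q0).
  apply: le_trans (VC x); apply: sumr_ge0 => b _; exact: mulr_ge0.
by rewrite VE mulr0 /m big1 // => y _; rewrite VE mul0r.
Qed.

End iid.

(** * Uniform batches average to the full loss *)

Section batches.
Context {R : realType} {d n : nat}.
Variables (f : 'I_n -> 'rV[R]_d -> R) (tau : nat).
Hypothesis htau : (1 <= tau <= n)%N.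

(** Batches avoiding [i] are the draws from its complement, so Pascal's rule leaves
    ['C(n.-1, tau.-1)] batches containing [i]. *)
Lemma card_batches_containing (i : 'I_n) :
  (n * #|[set B : {set 'I_n} | (#|B| == tau) && (i \in B)]%SET| = tau * 'C(n, tau))%N.
Proof.
case/andP: htau => t0 tn.
have n0 : (0 < n)%N by exact: leq_trans tn.
have := cards_draws [set: 'I_n]%SET tau; rewrite cardsT card_ord => hT.
have := cards_draws [set~ i]%SET tau; rewrite cardsC1 card_ord => hi.
set A := [set B : {set 'I_n} | (#|B| == tau) && (i \in B)]%SET.
have hA : (#|A| + 'C(n.-1, tau) = 'C(n, tau))%N.
  rewrite -hT -hi -cardsUI.
  rewrite (_ : _ :&: _ = finset.set0) ?cards0 ?addn0; last first.
    apply/setP => B; rewrite !inE finset.subsetC finset.sub1set !inE.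
    by case: (i \in B); rewrite ?andbF ?andbT.
  apply: eq_card => B; rewrite !inE finset.subsetT finset.subsetC finset.sub1set !inE /=.
  by case: (i \in B); case: (#|B| == tau).
have : #|A| = 'C(n.-1, tau.-1).
  apply/eqP; rewrite -(eqn_add2r 'C(n.-1, tau)) hA.
  by rewrite -{1}(prednK n0) -{1 3}(prednK t0) binS addnC.
by move=> ->; rewrite mul_bin_diag prednK.
Qed.

(** After exchanging the sums, each [f i] is weighted by the number of batches containing [i], which
    is the same for all [i]. *)
Lemma average_batch_loss x :
  \sum_(B : {set 'I_n} | #|B| == tau) ('C(n, tau)%:R^-1 * batch_loss f tau B x) =
  full_loss f x.
Proof.
case/andP: (htau) => t0 tn; have n0 : (0 < n)%N by exact: leq_trans tn.
have C0 : ('C(n, tau)%:R : R) != 0 by rewrite pnatr_eq0 -lt0n bin_gt0.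
have t0' : (tau%:R : R) != 0 by rewrite pnatr_eq0 -lt0n.
have n0' : (n%:R : R) != 0 by rewrite pnatr_eq0 -lt0n.
under eq_bigr do rewrite /batch_loss mulrA mulr_sumr.
rewrite (exchange_big_dep xpredT) //= /full_loss mulr_sumr.
apply: eq_bigr => i _; rewrite sumr_const -[LHS]mulr_natr.
rewrite mulrAC; congr (_ * _).
have /(congr1 (fun k => k%:R : R)) := card_batches_containing i.
rewrite !natrM cardsE => e.
apply: (mulfI n0'); rewrite mulrC -mulrA (mulrC _ n%:R) e.
by field; rewrite n0' C0 t0'.
Qed.

End batches.

(** * Batch losses inherit differentiability, convexity and smoothness *)

Section batch_regularity.
Context {R : realType} {d n : nat}.
Variables (f : 'I_n -> 'rV[R]_d -> R) (tau : nat) (B : {set 'I_n}).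
Hypothesis df : forall i x, differentiable (f i) x.

Lemma batch_lossE : batch_loss f tau B = tau%:R^-1 *: \sum_(i in B) f i.
Proof. by apply/funext => y; rewrite /batch_loss fct_sumE. Qed.

Lemma differentiable_batch_loss x : differentiable (batch_loss f tau B) x.
Proof.
rewrite batch_lossE; apply: differentiableZ.
by elim/big_ind: _ => // g h dg dh; exact: differentiableD.
Qed.

Lemma gradient_batch_loss x :
  gradient (batch_loss f tau B) x = tau%:R^-1 *: \sum_(i in B) gradient (f i) x.
Proof.
apply/rowP => j; rewrite !mxE summxE.
have dS : is_derive x (delta_mx 0 j) (\sum_(i in B) f i)
    (\sum_(i in B) 'D_(delta_mx 0 j) (f i) x).
  elim/big_rec2: _ => [|i y g _ dg]; first exact: is_derive_cst.
  by apply: is_deriveD; split=> //; exact: diff_derivable.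
rewrite batch_lossE derive_val.
by congr (_ * _); apply: eq_bigr => i _; rewrite mxE.
Qed.

Lemma convex_batch_loss : (forall i, convex_on_space (f i)) ->
  convex_on_space (batch_loss f tau B).
Proof.
move=> cf t x y xT yT; rewrite convRE /batch_loss.
rewrite mulrCA (mulrCA (unstable.onem _)) -mulrDr ler_wpM2l ?invr_ge0 //.
rewrite !mulr_sumr -big_split; apply: ler_sum => i _ /=.
by have := cf i t x y xT yT; rewrite convRE.
Qed.

Lemma lipschitz_gradient_batch_loss M : (0 < tau)%N -> #|B| = tau ->
  (forall i, lipschitz_gradient M (f i)) ->
  lipschitz_gradient M (batch_loss f tau B).
Proof.
move=> t0 Bt lf x y; rewrite !gradient_batch_loss -scalerBr enormZ.
rewrite ger0_norm ?invr_ge0 // ler_pdivrMl ?ltr0n // -sumrB.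
apply: le_trans (ler_enorm_sum _ _ _ _) _.
apply: (@le_trans _ _ (\sum_(i in B) M * enorm (x - y))).
  by apply: ler_sum => i _; exact: lf.
by rewrite sumr_const Bt mulr_natl.
Qed.

End batch_regularity.

(** * Linear convergence of the iterates *)

Lemma usam_sps_iter_hist (R : realType) (d n : nat) (f : 'I_n -> 'rV[R]_d -> R)
    (tau : nat) (ell : {set 'I_n} -> R) (rho : R) (x0 : 'rV[R]_d)
    (s : nat -> {set 'I_n}) (t : nat) :
  usam_sps_iter f tau ell rho x0 s t =
  hist_state _ (fun B => usam_sps_step rho (ell B) (batch_loss f tau B)) x0 t
    (hist_of s t).
Proof.
elim: t => [|t IH]; first reflexivity.
by rewrite [LHS]/= IH.
Qed.

Theorem corollary3p6 (R : realType) (d n : nat)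
  (f : 'I_n -> 'rV[R]_d -> R) (L : 'I_n -> R) (mu rho : R)
  (tau : nat) (ell : {set 'I_n} -> R) (xstar x0 : 'rV[R]_d)
  (dsp : measure_display) (Omega : measurableType dsp)
  (P : probability Omega R) (S : nat -> Omega -> {set 'I_n})
  (htau : (1 <= tau <= n)%N)
  (hdiff : forall i x, differentiable (f i) x)
  (hlb : forall i, has_lbound (range (f i)))
  (hconv : forall i, convex_on_space (f i))
  (hL : forall i, 0 < L i)
  (hsmooth : forall i, lipschitz_gradient (L i) (f i))
  (hmu : 0 < mu)
  (hstrong : strongly_convex mu (full_loss f))
  (hmin : forall x, full_loss f xstar <= full_loss f x)
  (hrho : 0 <= rho <= 1 / max_of L)
  (hell : forall B : {set 'I_n}, #|B| = tau ->
     forall x, ell B <= batch_loss f tau B x)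
  (hS : iid_uniform_batches P tau S)
  (hinterp : forall t : nat,
     ('E_P[fun w => (batch_loss f tau (S t w) xstar - ell (S t w))%R] = 0)%E) :
  forall t : nat,
    ('E_P[fun w =>
        (enorm (usam_sps_iter f tau ell rho x0 (S^~ w) t - xstar) ^+ 2)%R]
     <= ((1 - mu * (1 - max_of L * rho) ^+ 2 / (4 * max_of L)) ^+ t
          * enorm (x0 - xstar) ^+ 2)%:E)%E.
Proof.
case: hS => mS uS iS; case/andP: (htau) => tau0 taun; case/andP: hrho => rho0 rhoM.
set M := max_of L in rhoM *.
have LM i : L i <= M by exact: le_bigmax.
have M0 : 0 < M.
  have n0 : (0 < n)%N by exact: leq_trans taun.
  exact: lt_le_trans (hL (Ordinal n0)) (LM _).
have fM i : lipschitz_gradient M (f i).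
  move=> x y; apply: le_trans (hsmooth i x y) _.
  by rewrite ler_wpM2r // enorm_ge0.
have Mrho : M * rho <= 1 by move: rhoM; rewrite ler_pdivlMr // mulrC.
pose p (B : {set 'I_n}) : R := if #|B| == tau then 'C(n, tau)%:R^-1 else 0.
have pS t B : P (S t @^-1` [set B]) = (p B)%:E by rewrite uS /p; case: ifP.
have Cinv : 0 < ('C(n, tau)%:R^-1 : R) by rewrite invr_gt0 ltr0n bin_gt0.
have sump (F : {set 'I_n} -> R) :
    \sum_B p B * F B =
    \sum_(B : {set 'I_n} | #|B| == tau) 'C(n, tau)%:R^-1 * F B.
  rewrite [RHS]big_mkcond /=; apply: eq_bigr => B _; rewrite /p.
  by case: ifP; rewrite ?mul0r.
(* The zero expectation is a sum of nonnegative gaps with positive weights over the batches of size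
   [tau], so each gap vanishes. *)
have interp (B : {set 'I_n}) : #|B| = tau -> batch_loss f tau B xstar = ell B.
  move=> Bt; have := hinterp 0%N.
  rewrite (@expectation_fin _ _ _ P _ (S 0%N)
    (fun B => batch_loss f tau B xstar - ell B)); last by move=> ?; exact: mS.
  under eq_bigr do rewrite pS /= mulrC.
  move=> [] /eqP; rewrite sump psumr_eq0 => [|C /eqP Ct]; last first.
    by rewrite mulr_ge0 // ?subr_ge0 ?hell // ltW.
  move=> /allP /(_ B); rewrite mem_index_enum Bt eqxx => /(_ isT).
  by rewrite mulf_eq0 gt_eqF //= subr_eq0 => /eqP.
(* The iterate is now a function of a finite history, which reduces the claim to a contraction of
   the squared distance at one fixed [x]. *)
move=> t; under [X in 'E_P[X]%E]eq_fun do rewrite usam_sps_iter_hist.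
apply: (iid_expectation_contraction P _ S mS iS _ _ x0
  (fun x => enorm (x - xstar) ^+ 2) p) => // [x|x]; first exact: sqr_ge0.
set c := (1 - M * rho) ^+ 2 / (2 * M).
have c0 : 0 <= c by rewrite divr_ge0 ?sqr_ge0 // mulr_ge0 // ltW.
have step (B : {set 'I_n}) : #|B| == tau ->
    enorm (usam_sps_step rho (ell B) (batch_loss f tau B) x - xstar) ^+ 2 <=
    enorm (x - xstar) ^+ 2
      - c * (batch_loss f tau B x - batch_loss f tau B xstar).
  move=> /eqP Bt; rewrite (interp B Bt).
  apply: usam_sps_step_descent => //.
  - by move=> z; exact: differentiable_batch_loss.
  - exact: lipschitz_gradient_batch_loss.
  - exact: hell.
  - exact: convex_batch_loss.
  - exact: interp.
rewrite sump.
apply: (@le_trans _ _ (\sum_(B : {set 'I_n} | #|B| == tau) ('C(n, tau)%:R^-1 *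
   (enorm (x - xstar) ^+ 2
      - c * (batch_loss f tau B x - batch_loss f tau B xstar))))).
  by apply: ler_sum => B Bt; rewrite ler_wpM2l ?(ltW Cinv) ?step.
set A := enorm (x - xstar) ^+ 2; set k := 'C(n, tau)%:R^-1.
rewrite (eq_bigr (fun B => k * A - c *
    (k * batch_loss f tau B x - k * batch_loss f tau B xstar))); last first.
  by move=> B _; ring.
rewrite sumrB -mulr_suml -mulr_sumr sumrB !average_batch_loss //.
have -> : \sum_(B : {set 'I_n} | #|B| == tau) k = 1.
  have := cards_draws [set: 'I_n]%SET tau; rewrite cardsT card_ord => hT.
  rewrite (eq_bigl [in [set B : {set 'I_n} | #|B| == tau]%SET]); last first.
    by move=> B; rewrite inE.
  rewrite sumr_const -[LHS]mulr_natr (_ : #|_| = 'C(n, tau)).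
    by rewrite mulVf // pnatr_eq0 -lt0n bin_gt0.
  by rewrite -hT; apply: eq_card => B; rewrite !inE finset.subsetT.
(* The averaged decrease is [c (f(x) - f(xstar))]; growth turns it into [c mu / 2] times the squared
   distance, whence the 4 in the rate. *)
have := strongly_convex_growth _ _ _ x hstrong hmin.
move=> /(ler_wpM2l c0).
have -> : c * (mu / 2 * A) =
   mu * (1 - M * rho) ^+ 2 / (4 * M) * A.
  by rewrite /c; field; rewrite gt_eqF.
lra.
Qed.
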